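(* Let $h:(0,1)\to(0,\infty)$ be a continuous function with $\lim_{t\to 0^+}h(t)=0$. Let $(z_n)_{n\ge 1}$, $z_n=r_ne^{i\theta_n}$ with $r_n\in(0,1)$ and $\theta_n\in\mathbb{R}$, be a Blaschke sequence in the unit disc $\mathbb{D}$ such that $\sum_{n=1}^{\infty}h(1-r_n)<\infty$, and let $B$ be the Blaschke product with zeros $(z_n)_{n\ge1}$. Suppose that there is $q\in(1/2,1]$ such that $h(t)/t^{q}$ is decreasing and $h(t)/t^{1-q}$ is increasing on $(0,1)$. Then, for any $p\ge q$, \[ \int_{0}^{2\pi}|B'(re^{i\theta})|^{p}\,d\theta=\frac{O(1)}{(1-r)^{p-1}\,h(1-r)}\qquad (r\to1^-). \] Moreover, if $\lim_{t\to0^+}h(t)/t^{1-q}=0$, then $O(1)$ can be replaced by $o(1)$, i.e. for any $p\ge q$, \[ \int_{0}^{2\pi}|B'(re^{i\theta})|^{p}\,d\theta=\frac{o(1)}{(1-r)^{p-1}\,h(1-r)}\qquad (r\to1^-). \]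
   Context: $\mathbb{D}$ is the open unit disc in $\mathbb{C}$. A Blaschke sequence is a sequence $(z_n)_{n\ge1}$ in $\mathbb{D}\setminus\{0\}$ with $\sum_{n}(1-|z_n|)<\infty$; the Blaschke product with these zeros is $B(z)=\prod_{n=1}^{\infty}\frac{|z_n|}{z_n}\,\frac{z_n-z}{1-\bar z_n z}$, $z\in\mathbb{D}$, which is analytic and bounded by $1$ on $\mathbb{D}$. ''Increasing'' and ''decreasing'' are understood in the weak (non-strict) sense. *)

(* Defs.v *)
From mathcomp Require Import all_boot all_order all_algebra.
From mathcomp Require Import all_classical all_reals all_analysis.
From mathcomp Require Import complex.

Set Implicit Arguments.
Unset Strict Implicit.
Unset Printing Implicit Defensive.

Import Order.TTheory GRing.Theory Num.Theory.
Import numFieldNormedType.Exports.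

Local Open Scope classical_set_scope.
Local Open Scope ring_scope.

(* Going through numFieldType gives R[i] its canonical norm topology, and makes
   derive1 on functions CC R -> CC R the complex derivative. *)
Definition CC (R : realType) : numFieldType := R[i].

(* The library norm `|z| takes its values in R[i] itself; cmod is R-valued. *)
Definition cmod (R : realType) (z : CC R) : R := ComplexField.Normc.normc z.

Definition polar (R : realType) (r t : R) : CC R :=
  ((r * cos t) +i* (r * sin t))%C.

(* All terms 1 - |z_n| are positive, so the sum is finite iff the partial sums
   converge. *)
Definition blaschke_sequence (R : realType) (z : nat -> CC R) : Prop :=
  (forall n, z n != 0 /\ cmod (z n) < 1) /\
  cvgn (series (fun n => 1 - cmod (z n))).

Definition blaschke_factor (R : realType) (a w : CC R) : CC R :=
  `|a| / a * ((a - w) / (1 - conjc a * w)).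

Definition blaschke_product (R : realType) (z : nat -> CC R) (w : CC R) : CC R :=
  limn (fun N => \prod_(0 <= n < N) blaschke_factor (z n) w).

Definition circle_integral (R : realType) (f : CC R -> CC R) (p r : R) : \bar R :=
  \int[lebesgue_measure]_(t in `[0, 2 * pi])
    (cmod (derive1 f (polar r t)) `^ p)%:E.

(* Main.v *)
Require Import Defs.
From mathcomp Require Import all_boot all_order all_algebra.
From mathcomp Require Import all_classical all_reals all_analysis.
From mathcomp Require Import measurable_realfun complex ring lra.

(* The derivative of [B] is estimated through difference quotients, which makes
   complex function theory unnecessary. Telescoping the partial products gives
   |B'(z)| <= 2 sum_n (1 - |z_n|^2) / |1 - conj(z_n) z|^2, and the Pick matrices
   of the partial products give the Schwarz-Pick type bound
   |B'(z)| <= 2 / (1 - |z|). For q <= 1 the q-th power of the sum is at most the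
   sum of the q-th powers, and for 2q > 1 the integral of
   |1 - conj(z_n) r e^(it)|^(-2q) is O((1 - r |z_n|)^(1 - 2q)); the remaining
   exponent p - q is absorbed by the second bound. Finally, with d = 1 - |z_n|
   and s = 1 - r, the monotonicity of h(t)/t^q (if d <= s) and of h(t)/t^(1-q)
   (if d > s) yields
   d^q (1 - r |z_n|)^(1 - 2q) <= h(d) s^(1 - q) / h(s),
   while the left-hand side is also at most 1. Summing the first bound gives
   O(1); using the second one for finitely many n gives o(1). *)

Import Order.TTheory GRing.Theory Num.Theory.
Import numFieldNormedType.Exports.

Set Implicit Arguments.
Unset Strict Implicit.
Unset Printing Implicit Defensive.

Local Open Scope classical_set_scope.
Local Open Scope ring_scope.

(** * Moduli and Blaschke factors *)

Section Cmod.
Context {R : realType}.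
Implicit Types x y z w a : CC R.

Lemma norm_cmod z : `|z| = (cmod z)%:C%C.
Proof. by case: z => a b; rewrite normc_def. Qed.

Lemma cmod_ge0 z : 0 <= cmod z.
Proof. by case: z => a b; rewrite /cmod /=; exact: sqrtr_ge0. Qed.

Lemma cmodM x y : cmod (x * y) = cmod x * cmod y.
Proof. exact: ComplexField.Normc.normcM. Qed.

Lemma cmodV x : cmod x^-1 = (cmod x)^-1.
Proof. exact: ComplexField.Normc.normcV. Qed.

Lemma cmod1 : cmod (1 : CC R) = 1.
Proof. exact: ComplexField.Normc.normc1. Qed.

Lemma cmod0 : cmod (0 : CC R) = 0.
Proof. exact: ComplexField.Normc.normc0. Qed.

Lemma cmodD x y : cmod (x + y) <= cmod x + cmod y.
Proof. exact: le_normcD. Qed.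

Lemma cmodN x : cmod (- x) = cmod x.
Proof. exact: normcN. Qed.

Lemma cmod_conj x : cmod (conjc x) = cmod x.
Proof. by case: x => a b; rewrite /cmod /= sqrrN. Qed.

Lemma cmodC x y : cmod (x - y) = cmod (y - x).
Proof. by rewrite -cmodN opprB. Qed.

Lemma cmod_dist x y : cmod x - cmod y <= cmod (x - y).
Proof. by rewrite lerBlDr; apply: le_trans (cmodD _ _); rewrite subrK. Qed.

Lemma cmod_eq0 x : (cmod x == 0) = (x == 0).
Proof.
apply/eqP/eqP => [|->]; last exact: cmod0.
exact: ComplexField.Normc.eq0_normc.
Qed.

Lemma cmod_real (k : R) : cmod (k%:C%C : CC R) = `|k|.
Proof. by rewrite /cmod /= expr0n /= addr0 sqrtr_sqr. Qed.

Lemma sqr_cmod z : cmod z ^+ 2 = complex.Re z ^+ 2 + complex.Im z ^+ 2.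
Proof.
by case: z => a b; rewrite /cmod /= sqr_sqrtr// addr_ge0 ?sqr_ge0.
Qed.

Lemma mul_conjc z : z * conjc z = (cmod z ^+ 2)%:C%C.
Proof. by rewrite -sqr_normc norm_cmod rmorphXn. Qed.

(** The link between Pick determinants and pseudohyperbolic distance: it trades |1 - conj(z) w| for
    |z - w| in the Schwarz-Pick bound. *)
Lemma sqr_cmod_pick z w :
  cmod (1 - conjc z * w) ^+ 2 =
  cmod (z - w) ^+ 2 + (1 - cmod z ^+ 2) * (1 - cmod w ^+ 2).
Proof. by rewrite !sqr_cmod; case: z => a b; case: w => c d /=; ring. Qed.

Lemma cmod_pick_ge z w : cmod w <= 1 -> 1 - cmod z <= cmod (1 - conjc z * w).
Proof.
move=> w1; apply: le_trans (cmod_dist _ _); rewrite cmod1 lerD2l lerN2.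
by rewrite cmodM cmod_conj ler_piMr ?cmod_ge0.
Qed.

Lemma conjcM x y : conjc (x * y) = conjc x * conjc y.
Proof.
by case: x => a b; case: y => c d; apply/eqP; rewrite eq_complex /=; apply/andP;
  split; apply/eqP; ring.
Qed.

Lemma conj_pick z w : conjc (1 - conjc z * w) = 1 - conjc w * z.
Proof.
by case: z => a b; case: w => c d; apply/eqP; rewrite eq_complex /=; apply/andP;
  split; apply/eqP; ring.
Qed.

Lemma conjcB x y : conjc (x - y) = conjc x - conjc y.
Proof.
by case: x => a b; case: y => c d; apply/eqP; rewrite eq_complex /=; apply/andP;
  split; apply/eqP; ring.
Qed.

Lemma real_sqr_pick z : (1 - cmod z ^+ 2)%:C%C = 1 - z * conjc z :> CC R.
Proof. by rewrite mul_conjc rmorphB rmorph1. Qed.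

Lemma cmod_pickC z w : cmod (1 - conjc z * w) = cmod (1 - conjc w * z).
Proof.
by rewrite -conj_pick cmod_conj.
Qed.

End Cmod.

Section BlaschkeFactor.
Context {R : realType}.
Variable a : CC R.
Hypotheses (a0 : a != 0) (a1 : cmod a < 1).
Implicit Types z w : CC R.

Lemma pick_neq0 z w : cmod z < 1 -> cmod w <= 1 -> 1 - conjc z * w != 0.
Proof.
move=> z1 w1; rewrite -cmod_eq0 gt_eqF//.
have z0 : 0 < 1 - cmod z by rewrite subr_gt0.
exact: lt_le_trans z0 (cmod_pick_ge z w1).
Qed.

Lemma cmod_unimodular : cmod (`|a| / a) = 1.
Proof.
rewrite cmodM norm_cmod cmod_real cmodV ger0_norm ?cmod_ge0// divff//.
by rewrite cmod_eq0.
Qed.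

Lemma conj_norm : conjc (`|a| : CC R) = `|a|.
Proof. by rewrite norm_cmod conjc_real. Qed.

(** The unimodular constant |a| / a cancels against its conjugate. Divided by 1 - conj(z) w, the
    right-hand side is a rank-one kernel, so the 2x2 Pick determinant of a single factor
    vanishes. *)
Lemma blaschke_factor_pick z w : cmod z < 1 -> cmod w < 1 ->
  1 - conjc (blaschke_factor a z) * blaschke_factor a w =
  (1 - conjc a * a) * (1 - conjc z * w) /
  ((1 - a * conjc z) * (1 - conjc a * w)).
Proof.
move=> z1 w1; rewrite /blaschke_factor !conjcM !conjc_inv conj_pick conjcB conj_norm.
rewrite [conjc z * a]mulrC.
have d1 : 1 - a * conjc z != 0.
  by rewrite mulrC pick_neq0// ltW.
have d2 := pick_neq0 a1 (ltW w1).
have ac0 : conjc a != 0 by rewrite conjc_eq0.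
have -> : `|a| / conjc a * ((conjc a - conjc z) / (1 - a * conjc z)) *
   (`|a| / a * ((a - w) / (1 - conjc a * w))) =
   `|a| ^+ 2 / (a * conjc a) *
   ((conjc a - conjc z) / (1 - a * conjc z) * ((a - w) / (1 - conjc a * w))).
  by field; rewrite /= d1 d2 a0 ac0.
rewrite sqr_normc divff ?mulf_neq0// mul1r.
by field; rewrite /= d1 d2.
Qed.

Lemma cmod_blaschke_factor_pick z w : cmod z < 1 -> cmod w < 1 ->
  cmod (1 - conjc (blaschke_factor a z) * blaschke_factor a w) =
  (1 - cmod a ^+ 2) * cmod (1 - conjc z * w) /
  (cmod (1 - conjc a * z) * cmod (1 - conjc a * w)).
Proof.
move=> z1 w1; rewrite blaschke_factor_pick// !cmodM cmodV cmodM.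
rewrite [conjc a * a]mulrC -real_sqr_pick cmod_real.
rewrite ger0_norm ?subr_ge0 ?expr_le1 ?cmod_ge0 ?ltW//.
by rewrite [a * _]mulrC (cmod_pickC z a).
Qed.

Lemma blaschke_factor_defect z : cmod z < 1 ->
  1 - cmod (blaschke_factor a z) ^+ 2 =
  (1 - cmod a ^+ 2) * (1 - cmod z ^+ 2) / cmod (1 - conjc a * z) ^+ 2.
Proof.
(* Over the complex numbers the identity is the diagonal case z = w of [blaschke_factor_pick]. *)
move=> z1; suff : (1 - cmod (blaschke_factor a z) ^+ 2)%:C%C =
    ((1 - cmod a ^+ 2) * (1 - cmod z ^+ 2) / cmod (1 - conjc a * z) ^+ 2)%:C%C :> CC R.
  by case.
rewrite real_sqr_pick mulrC blaschke_factor_pick//.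
have -> (x y k : R) : (x * y / k)%:C%C = x%:C%C * y%:C%C / k%:C%C :> CC R.
  by rewrite !rmorphM fmorphV.
rewrite !real_sqr_pick -mul_conjc conj_pick.
by rewrite ![conjc _ * _]mulrC [X in _ / X]mulrC.
Qed.

Lemma cmod_blaschke_factor_le1 z : cmod z < 1 -> cmod (blaschke_factor a z) <= 1.
Proof.
move=> z1; have : 0 <= 1 - cmod (blaschke_factor a z) ^+ 2.
  rewrite blaschke_factor_defect// divr_ge0 ?sqr_ge0//.
  by rewrite mulr_ge0 ?subr_ge0 ?expr_le1 ?cmod_ge0 ?ltW.
by rewrite subr_ge0 expr_le1 ?cmod_ge0.
Qed.

Lemma blaschke_factorB z w : cmod z < 1 -> cmod w < 1 ->
  cmod (blaschke_factor a w - blaschke_factor a z) =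
  cmod (w - z) *
    ((1 - cmod a ^+ 2) / (cmod (1 - conjc a * w) * cmod (1 - conjc a * z))).
Proof.
move=> z1 w1; rewrite /blaschke_factor -mulrBr cmodM cmod_unimodular mul1r.
have d1 := pick_neq0 a1 (ltW z1).
have d2 := pick_neq0 a1 (ltW w1).
have -> : (a - w) / (1 - conjc a * w) - (a - z) / (1 - conjc a * z) =
   (z - w) * ((1 - a * conjc a) / ((1 - conjc a * w) * (1 - conjc a * z))).
  by field; rewrite /= d1 d2.
rewrite !cmodM cmodV cmodM cmodC -real_sqr_pick cmod_real.
by rewrite ger0_norm ?subr_ge0 ?expr_le1 ?cmod_ge0 ?ltW.
Qed.

(** The factor 1 - |a| can be pulled out of 1 - b(w); its summability makes the partial products
    converge. *)
Lemma blaschke_factor_near1 w : cmod w < 1 ->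
  cmod (1 - blaschke_factor a w) <= (1 - cmod a) * (2 / (1 - cmod w)).
Proof.
move=> w1.
have d2 := pick_neq0 a1 (ltW w1).
have ac0 : conjc a != 0 by rewrite conjc_eq0.
have na : (`|a| : CC R) ^+ 2 = a * conjc a by rewrite sqr_normc.
have -> : 1 - blaschke_factor a w =
   (1 - `|a|) * ((1 + `|a| / a * w) / (1 - conjc a * w)).
  rewrite /blaschke_factor.
  apply/eqP; rewrite -subr_eq0; apply/eqP.
  (* The two sides agree only because |a|^2 = a conj(a), a fact invisible to [field]; their
     difference is a multiple of this defect. *)
  transitivity ((`|a| ^+ 2 - a * conjc a) * w / (a * (1 - conjc a * w))).
    by field; rewrite /= a0 d2.
  by rewrite na subrr !mul0r.
have n1 : cmod (1 - `|a|) = 1 - cmod a.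
  rewrite norm_cmod -(rmorph1 (real_complex R)) -rmorphB cmod_real.
  by rewrite ger0_norm ?subr_ge0 ?ltW.
rewrite cmodM n1 ler_wpM2l ?subr_ge0 ?(ltW a1)//.
rewrite cmodM cmodV ler_pM ?invr_ge0 ?cmod_ge0//.
  apply: le_trans (cmodD _ _) _; rewrite cmod1 cmodM cmod_unimodular.
  by rewrite mul1r (natrD _ 1 1) lerD2l ltW.
rewrite lef_pV2 ?posrE ?subr_gt0//; last by rewrite lt0r cmod_eq0 d2 cmod_ge0.
by rewrite cmod_pickC; apply: cmod_pick_ge; exact: ltW.
Qed.

End BlaschkeFactor.

(** * Partial products *)

Section FiniteProduct.
Context {R : realType}.
Variable a : nat -> CC R.
Hypotheses (a0 : forall n, a n != 0) (a1 : forall n, cmod (a n) < 1).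
Implicit Types z w : CC R.

Definition blaschke_partial (N : nat) w := \prod_(0 <= n < N) blaschke_factor (a n) w.

Lemma blaschke_partialS N w :
  blaschke_partial N.+1 w = blaschke_partial N w * blaschke_factor (a N) w.
Proof. by rewrite /blaschke_partial big_nat_recr. Qed.

Lemma blaschke_partial0 w : blaschke_partial 0 w = 1.
Proof. by rewrite /blaschke_partial big_geq. Qed.

Lemma blaschke_partial_le1 N w : cmod w < 1 -> cmod (blaschke_partial N w) <= 1.
Proof.
move=> w1; elim: N => [|N IH]; first by rewrite blaschke_partial0 cmod1.
by rewrite blaschke_partialS cmodM mulr_ile1 ?cmod_ge0 ?cmod_blaschke_factor_le1.
Qed.

(** Induction by the discrete product rule P b - Q c = (P - Q) b + Q (b - c), where b and Q have
    modulus at most 1. *)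
Lemma blaschke_partialB N z w : cmod z < 1 -> cmod w < 1 ->
  cmod (blaschke_partial N w - blaschke_partial N z) <= cmod (w - z) *
    \sum_(0 <= n < N) ((1 - cmod (a n) ^+ 2) /
       (cmod (1 - conjc (a n) * w) * cmod (1 - conjc (a n) * z))).
Proof.
move=> z1 w1; elim: N => [|N IH].
  by rewrite !blaschke_partial0 subrr cmod0 big_geq// mulr0.
rewrite !blaschke_partialS big_nat_recr//= mulrDr -blaschke_factorB//.
set P := blaschke_partial N w; set Q := blaschke_partial N z.
set b := blaschke_factor _ w; set c := blaschke_factor _ z.
have -> : P * b - Q * c = (P - Q) * b + Q * (b - c) by ring.
apply: le_trans (cmodD _ _) _; rewrite (cmodM _ b) (cmodM Q) lerD//.
  by apply: le_trans IH; rewrite ler_piMr ?cmod_ge0 ?cmod_blaschke_factor_le1.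
by rewrite ler_piMl ?cmod_ge0 ?blaschke_partial_le1.
Qed.

(* Nonnegativity of the determinant of a 2x2 Pick matrix is inherited by
   products, since 1 - conj(fg) fg = (1 - conj f f) + conj f f (1 - conj g g);
   the determinant of a sum is handled by Cauchy-Schwarz. *)
Lemma pick_det_sum (s K p1 p2 q1 q2 U V : R) : 0 <= s -> 0 <= K ->
  0 <= p1 -> 0 <= p2 -> 0 <= q1 -> 0 <= q2 -> 0 <= U -> 0 <= V ->
  U ^+ 2 * s <= p1 * p2 * K ^+ 2 -> V ^+ 2 * s <= q1 * q2 * K ^+ 2 ->
  (U + V) ^+ 2 * s <= (p1 + q1) * (p2 + q2) * K ^+ 2.
Proof.
move=> s0 K0 p10 p20 q10 q20 U0 V0 HU HV.
(* The cross term: multiply the two hypotheses, then use 4 xy <= (x + y)^2 with x = p1 q2 and y = q1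
   p2. *)
have mid : 2 * U * V * s <= (p1 * q2 + q1 * p2) * K ^+ 2.
  rewrite -ler_sqr ?nnegrE; last 2 first.
  - by rewrite !mulr_ge0.
  - by rewrite mulr_ge0 ?sqr_ge0// addr_ge0// mulr_ge0.
  have -> : (2 * U * V * s) ^+ 2 = 4 * ((U ^+ 2 * s) * (V ^+ 2 * s)) by ring.
  have h1 : (U ^+ 2 * s) * (V ^+ 2 * s) <= (p1 * p2 * K ^+ 2) * (q1 * q2 * K ^+ 2).
    by apply: ler_pM => //; rewrite mulr_ge0 ?sqr_ge0.
  have h2 : 0 <= (p1 * q2 - q1 * p2) ^+ 2 * (K ^+ 2) ^+ 2.
    by rewrite mulr_ge0 ?sqr_ge0.
  lra.
lra.
Qed.

(** The 2x2 Pick determinant of the partial product at z and w is nonnegative; denominators are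
    cleared. Induction on N, starting from the constant 1, for which both sides are 0. *)
Lemma blaschke_partial_pick N z w : cmod z < 1 -> cmod w < 1 ->
  cmod (1 - conjc (blaschke_partial N z) * blaschke_partial N w) ^+ 2 *
    ((1 - cmod z ^+ 2) * (1 - cmod w ^+ 2)) <=
  (1 - cmod (blaschke_partial N z) ^+ 2) * (1 - cmod (blaschke_partial N w) ^+ 2) *
    cmod (1 - conjc z * w) ^+ 2.
Proof.
move=> z1 w1.
have le1 (u : CC R) : cmod u <= 1 -> 0 <= 1 - cmod u ^+ 2.
  by move=> u1; rewrite subr_ge0 expr_le1 ?cmod_ge0.
elim: N => [|N IH].
  rewrite !blaschke_partial0 conjc1 mul1r subrr cmod0 cmod1 expr1n subrr.
  by rewrite expr0n /= !mul0r.
rewrite !blaschke_partialS.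
set b := blaschke_factor _ w; set c := blaschke_factor _ z.
have b1 : cmod b <= 1 by rewrite cmod_blaschke_factor_le1.
have c1 : cmod c <= 1 by rewrite cmod_blaschke_factor_le1.
have := blaschke_partial_le1 N w1; have := blaschke_partial_le1 N z1.
move: IH; set P := blaschke_partial N w; set Q := blaschke_partial N z => IH Q1 P1.
(* The determinant of the new factor, weighted by |Q| and |P|, vanishes: the second input of
   [pick_det_sum] is an equality. *)
have bc : (cmod Q * cmod P * cmod (1 - conjc c * b)) ^+ 2 *
    ((1 - cmod z ^+ 2) * (1 - cmod w ^+ 2)) =
    (cmod Q ^+ 2 * (1 - cmod c ^+ 2)) * (cmod P ^+ 2 * (1 - cmod b ^+ 2)) *
    cmod (1 - conjc z * w) ^+ 2.
  rewrite /b /c !blaschke_factor_defect// cmod_blaschke_factor_pick//.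
  by rewrite !exprMn !exprVn !exprMn !invfM; ring.
have tri : cmod (1 - conjc (Q * c) * (P * b)) <=
    cmod (1 - conjc Q * P) + cmod Q * cmod P * cmod (1 - conjc c * b).
  have -> : 1 - conjc (Q * c) * (P * b) =
      (1 - conjc Q * P) + conjc Q * P * (1 - conjc c * b).
    by rewrite conjcM; ring.
  apply: le_trans (cmodD _ _) _.
  by rewrite (cmodM (conjc Q * P)) (cmodM (conjc Q)) cmod_conj.
have s0 : 0 <= (1 - cmod z ^+ 2) * (1 - cmod w ^+ 2).
  by rewrite mulr_ge0 ?le1 ?ltW.
apply: le_trans (_ : (cmod (1 - conjc Q * P) +
    cmod Q * cmod P * cmod (1 - conjc c * b)) ^+ 2 * ((1 - cmod z ^+ 2) * (1 - cmod w ^+ 2)) <= _).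
  by rewrite ler_wpM2r// ler_sqr ?nnegrE ?addr_ge0 ?mulr_ge0 ?cmod_ge0.
apply: le_trans (pick_det_sum s0 (cmod_ge0 (1 - conjc z * w)) (le1 _ Q1) (le1 _ P1)
   (mulr_ge0 (sqr_ge0 (cmod Q)) (le1 _ c1)) (mulr_ge0 (sqr_ge0 (cmod P)) (le1 _ b1))
   _ _ IH _) _; rewrite ?bc ?mulr_ge0 ?cmod_ge0//.
(* The diagonal entries add up: (1 - |Q|^2) + |Q|^2 (1 - |c|^2) = 1 - |Q c|^2, and likewise for P
   and b. *)
by rewrite (cmodM Q) (cmodM P) !exprMn le_eqVlt; apply/orP; left; apply/eqP; ring.
Qed.

(** By [sqr_cmod_pick], the determinant inequality says |Q - P| |1 - conj(z) w| <= |1 - conj(Q) P|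
    |z - w|. The first factor on the right is at most 2, and |1 - conj(z) w| >= 1 - |z|. *)
Lemma blaschke_partial_lipschitz N z w : cmod z < 1 -> cmod w < 1 ->
  cmod (blaschke_partial N w - blaschke_partial N z) <=
  cmod (w - z) * (2 / (1 - cmod z)).
Proof.
move=> z1 w1; have := blaschke_partial_pick N z1 w1.
have := blaschke_partial_le1 N w1; have := blaschke_partial_le1 N z1.
set P := blaschke_partial N w; set Q := blaschke_partial N z => Q1 P1 H.
have s0 : 0 < 1 - cmod z by rewrite subr_gt0.
have K0 : 1 - cmod z <= cmod (1 - conjc z * w) by apply: cmod_pick_ge; exact: ltW.
have X2 : cmod (1 - conjc Q * P) <= 2.
  have -> : (2 : R) = 1 + 1 by [].
  apply: le_trans (cmodD _ _) _; rewrite cmod1 lerD2l cmodN cmodM cmod_conj.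
  by rewrite mulr_ile1 ?cmod_ge0.
have HP := sqr_cmod_pick Q P; have Hz := sqr_cmod_pick z w.
have D : (cmod (Q - P) * cmod (1 - conjc z * w)) ^+ 2 <= (2 * cmod (z - w)) ^+ 2.
  rewrite !exprMn.
  have -> : cmod (Q - P) ^+ 2 = cmod (1 - conjc Q * P) ^+ 2 -
     (1 - cmod Q ^+ 2) * (1 - cmod P ^+ 2) by rewrite HP addrK.
  have hx : cmod (1 - conjc Q * P) ^+ 2 * cmod (z - w) ^+ 2 <= 2 ^+ 2 * cmod (z - w) ^+ 2.
    by rewrite ler_wpM2r ?sqr_ge0// ler_sqr ?nnegrE ?cmod_ge0.
  apply: le_trans hx; rewrite mulrBl.
  move: H; rewrite Hz; set X := cmod (1 - _); lra.
rewrite ler_sqr ?nnegrE ?mulr_ge0 ?cmod_ge0// in D.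
rewrite mulrA ler_pdivlMr// (cmodC P) (cmodC w).
apply: le_trans (_ : cmod (Q - P) * cmod (1 - conjc z * w) <= _).
  by rewrite ler_wpM2l ?cmod_ge0.
by rewrite [leRHS]mulrC.
Qed.

Lemma blaschke_partial_step N w : cmod w < 1 ->
  cmod (blaschke_partial N.+1 w - blaschke_partial N w) <=
  (1 - cmod (a N)) * (2 / (1 - cmod w)).
Proof.
move=> w1; rewrite blaschke_partialS.
set P := blaschke_partial N w; set b := blaschke_factor _ _.
have -> : P * b - P = P * (b - 1) by ring.
rewrite cmodM cmodC; apply: le_trans (blaschke_factor_near1 (a0 N) (a1 N) w1).
by rewrite ler_piMl ?cmod_ge0 ?blaschke_partial_le1.
Qed.

End FiniteProduct.

(** * Limits and difference quotients in the complex plane *)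

Section Limits.
Context {R : realType}.

Lemma summable_increments_cvg (x d : R ^nat) :
  (forall n, `|x n.+1 - x n| <= d n) -> cvgn (series d) -> cvgn x.
Proof.
move=> xd cd.
have : cvgn (series (telescope x)).
  apply: normed_cvg; apply: (series_le_cvg _ _ xd cd) => n //=.
  by apply: le_trans (xd n).
rewrite telescopeK => c.
have -> : x = (x - cst (x 0%N)) + cst (x 0%N) by rewrite subrK.
apply: is_cvgD => //; exact: is_cvg_cst.
Qed.

Lemma complex_gt0 (e : CC R) : 0 < e -> exists2 d : R, 0 < d & e = d%:C%C.
Proof.
by case: e => x y; rewrite ltcE /= => /andP[/eqP -> x0]; exists x.
Qed.

Lemma cmod_le_ReIm (z : CC R) : cmod z <= `|complex.Re z| + `|complex.Im z|.
Proof.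
rewrite -ler_sqr ?nnegrE ?addr_ge0 ?cmod_ge0//.
rewrite sqr_cmod sqrrD !real_normK ?num_real// -addrA lerD2l lerDr.
by rewrite mulrn_wge0// mulr_ge0.
Qed.

Lemma cmod_le_norm (z : CC R) (e : R) : (`|z| <= e%:C%C) = (cmod z <= e).
Proof. by rewrite norm_cmod lecR. Qed.

Lemma complex_cvg (u : nat -> CC R) :
  cvgn (fun n => complex.Re (u n)) -> cvgn (fun n => complex.Im (u n)) -> cvgn u.
Proof.
move=> /cvg_ex[x xu] /cvg_ex[y yu]; apply/cvg_ex; exists (x +i* y)%C.
apply/cvgrPdist_le => /= eps /complex_gt0[e e0 ->].
have e20 : 0 < e / 2 by rewrite divr_gt0.
move/cvgrPdist_le : xu => /(_ _ e20) xu.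
move/cvgrPdist_le : yu => /(_ _ e20) yu.
near=> n; rewrite cmod_le_norm; apply: le_trans (cmod_le_ReIm _) _.
rewrite [e]splitr lerD//.
  have : `|x - complex.Re (u n)| <= e / 2 by near: n.
  by case: (u n).
have : `|y - complex.Im (u n)| <= e / 2 by near: n.
by case: (u n).
Unshelve. all: end_near. Qed.

(* When the difference quotients diverge, [derive1] is the default point 0. *)
Lemma cmod_derive1_le (f : CC R -> CC R) (a : CC R) (M : R) : 0 <= M ->
  (\forall h \near (0 : CC R)^', cmod (h^-1 * (f (h + a) - f a)) <= M) ->
  cmod (derive1 f a) <= M.
Proof.
move=> M0 H; rewrite /derive1.
have [c|/dvgP ->] :=
  pselect (cvg (h^-1 *: (f (h + a) - f a) @[h --> (0 : CC R)^'])); last first.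
  by rewrite (_ : point = 0)// cmod0.
set l := lim _ in c *.
apply/ler_addgt0Pr => e e0.
have e0' : (0 : CC R) < e%:C%C by rewrite ltcR.
move/cvgrPdist_le : c => /(_ _ e0') c.
near (0 : CC R)^' => h.
have h1 : cmod (h^-1 * (f (h + a) - f a)) <= M by near: h.
have h2 : cmod (l - h^-1 * (f (h + a) - f a)) <= e.
  by rewrite -cmod_le_norm; near: h.
rewrite -[l](subrK (h^-1 * (f (h + a) - f a))).
by apply: le_trans (cmodD _ _) _; rewrite addrC lerD.
Unshelve. all: end_near. Qed.

End Limits.

(** * The infinite product and its derivative *)

Section InfiniteProduct.
Context {R : realType}.
Variable a : nat -> CC R.
Hypotheses (a0 : forall n, a n != 0) (a1 : forall n, cmod (a n) < 1).
Hypothesis sum_a : cvgn (series (fun n => 1 - cmod (a n))).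
Implicit Types z w : CC R.

Lemma Re_le_cmod (u : CC R) : `|complex.Re u| <= cmod u.
Proof.
rewrite -ler_sqr ?nnegrE ?cmod_ge0// sqr_cmod real_normK ?num_real//.
by rewrite lerDl sqr_ge0.
Qed.

Lemma Im_le_cmod (u : CC R) : `|complex.Im u| <= cmod u.
Proof.
rewrite -ler_sqr ?nnegrE ?cmod_ge0// sqr_cmod real_normK ?num_real//.
by rewrite lerDr sqr_ge0.
Qed.

Lemma blaschke_product_cvg w : cmod w < 1 ->
  blaschke_partial a N w @[N --> \oo] --> blaschke_product a w.
Proof.
move=> w1; rewrite /blaschke_product.
(* [blaschke_product] is a [limn], hence the actual limit as soon as one exists. Real and imaginary
   parts are treated separately, each with summable increments. *)
suff : cvgn (fun N => blaschke_partial a N w) by [].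
have cd : cvgn (series (fun n => (1 - cmod (a n)) * (2 / (1 - cmod w)))).
  under eq_fun do rewrite mulrC.
  exact: is_cvg_seriesZ.
apply: complex_cvg; apply: summable_increments_cvg cd => n;
  apply: le_trans (blaschke_partial_step a0 a1 n w1).
- apply: le_trans (Re_le_cmod _).
  by case: (blaschke_partial _ n.+1 _); case: (blaschke_partial _ _ _).
- apply: le_trans (Im_le_cmod _).
  by case: (blaschke_partial _ n.+1 _); case: (blaschke_partial _ _ _).
Qed.

Lemma cmod_blaschke_productB_le z w (M : R) : cmod z < 1 -> cmod w < 1 ->
  (forall N, cmod (blaschke_partial a N w - blaschke_partial a N z) <= M) ->
  cmod (blaschke_product a w - blaschke_product a z) <= M.
Proof.
move=> z1 w1 H; apply/ler_addgt0Pr => e e0.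
have e0' : (0 : CC R) < (e / 2)%:C%C by rewrite ltcR divr_gt0.
move/cvgrPdist_le: (blaschke_product_cvg z1) => /(_ _ e0') cz.
move/cvgrPdist_le: (blaschke_product_cvg w1) => /(_ _ e0') cw.
near \oo%classic => N.
have h1 : cmod (blaschke_product a z - blaschke_partial a N z) <= e / 2.
  by rewrite -cmod_le_norm; near: N.
have h2 : cmod (blaschke_product a w - blaschke_partial a N w) <= e / 2.
  by rewrite -cmod_le_norm; near: N.
have := H N; move: h1 h2.
set x := blaschke_product a z; set y := blaschke_product a w.
set p := blaschke_partial a N z; set q := blaschke_partial a N w => h1 h2 h3.
have -> : y - x = (q - p) + ((y - q) + (p - x)) by ring.
apply: le_trans (cmodD _ _) _; apply: lerD => //.
apply: le_trans (cmodD _ _) _; rewrite [e]splitr lerD//.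
by rewrite cmodC.
Unshelve. all: end_near. Qed.

(** Half the distance to the circle keeps z + h in the disc and makes |h| at most half of every |1 -
    conj(a_n) z|. *)
Lemma near_disc z : cmod z < 1 ->
  \forall h \near (0 : CC R)^', h != 0 /\ cmod h <= (1 - cmod z) / 2.
Proof.
move=> z1; have e0' : (0 : CC R) < ((1 - cmod z) / 2)%:C%C.
  by rewrite ltcR divr_gt0// subr_gt0.
near=> h; split; first by near: h; exact: nbhs_dnbhs_neq.
by rewrite -cmod_le_norm; near: h; exact: dnbhs0_le.
Unshelve. all: end_near. Qed.

Lemma near_disc_lt1 z h : cmod z < 1 -> cmod h <= (1 - cmod z) / 2 -> cmod (h + z) < 1.
Proof. move=> z1 hh; apply: le_lt_trans (cmodD _ _) _; lra. Qed.

Lemma cmod_slope_le (f : CC R -> CC R) z h (M : R) : h != 0 ->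
  cmod (f (h + z) - f z) <= cmod h * M ->
  cmod (h^-1 * (f (h + z) - f z)) <= M.
Proof.
move=> h0; have ch0 : 0 < cmod h by rewrite lt0r cmod_eq0 h0 cmod_ge0.
by rewrite cmodM cmodV ler_pdivrMl.
Qed.

(** The Lipschitz constant of the partial products does not depend on N, so it passes to the product
    and its difference quotients. *)
Lemma derive1_blaschke_le z : cmod z < 1 ->
  cmod (derive1 (blaschke_product a) z) <= 2 / (1 - cmod z).
Proof.
move=> z1; apply: cmod_derive1_le.
  by rewrite divr_ge0// subr_ge0 ltW.
apply: filterS (near_disc z1) => h [h0 hh].
apply: cmod_slope_le => //; have w1 := near_disc_lt1 z1 hh.
apply: cmod_blaschke_productB_le => // N.
by have := blaschke_partial_lipschitz a0 a1 N z1 w1; rewrite addrK.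
Qed.

(** The telescoped bound has one denominator at z and one at z + h. The factor 2 pays for moving the
    second one to z, uniformly in n. *)
Lemma derive1_blaschke_sum_le z (M : R) : cmod z < 1 ->
  (forall N, \sum_(0 <= n < N)
     ((1 - cmod (a n) ^+ 2) / cmod (1 - conjc (a n) * z) ^+ 2) <= M) ->
  cmod (derive1 (blaschke_product a) z) <= 2 * M.
Proof.
move=> z1 H; apply: cmod_derive1_le.
  (* The empty sum gives 0 <= M. *)
  by rewrite mulr_ge0//; have := H 0%N; rewrite big_geq.
apply: filterS (near_disc z1) => h [h0 hh].
apply: cmod_slope_le => //; have w1 := near_disc_lt1 z1 hh.
apply: cmod_blaschke_productB_le => // N.
have := blaschke_partialB a0 a1 N z1 w1; rewrite addrK => /le_trans; apply.
rewrite ler_wpM2l ?cmod_ge0//.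
apply: le_trans (_ : 2 * \sum_(0 <= n < N)
     ((1 - cmod (a n) ^+ 2) / cmod (1 - conjc (a n) * z) ^+ 2) <= _); last first.
  by rewrite ler_wpM2l.
rewrite mulr_sumr ler_sum// => n _; rewrite mulrCA ler_wpM2l//.
  by rewrite subr_ge0 expr_le1 ?cmod_ge0 ?ltW.
have Xz : 1 - cmod z <= cmod (1 - conjc (a n) * z).
  by rewrite cmod_pickC; apply: cmod_pick_ge; exact: ltW.
have Xw : cmod (1 - conjc (a n) * z) - cmod h <= cmod (1 - conjc (a n) * (h + z)).
  have -> : 1 - conjc (a n) * z = (1 - conjc (a n) * (h + z)) + conjc (a n) * h by ring.
  rewrite lerBlDr; apply: le_trans (cmodD _ _) _; rewrite lerD2l.
  by rewrite cmodM cmod_conj ler_piMl ?cmod_ge0 ?ltW.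
set X := cmod (1 - _ * z) in Xz Xw *; set Y := cmod (1 - _) in Xw *.
have X0 : 0 < X by apply: lt_le_trans Xz; rewrite subr_gt0.
(* Since X >= 1 - |z| >= 2 |h|, also Y >= X - |h| >= X / 2. *)
have Y0 : 0 < Y by lra.
rewrite -subr_ge0.
have -> : 2 * (X ^+ 2)^-1 - (Y * X)^-1 = (2 * Y - X) / (X ^+ 2 * Y).
  by field; rewrite !gt_eqF.
by rewrite divr_ge0 ?mulr_ge0 ?exprn_ge0 ?(ltW X0) ?(ltW Y0)//; lra.
Qed.

End InfiniteProduct.

(** * Kernel and trigonometric estimates *)

Section PowerKernel.
Context {R : realType}.
Variables (delta s : R).
Hypotheses (delta0 : 0 < delta) (s1 : 1 < s).

Lemma is_derive_shift_powR (e c x : R) : 0 < x + c ->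
  is_derive x 1 (fun t : R => (t + c) `^ e) (e * (x + c) `^ (e - 1)).
Proof.
move=> xc; rewrite -[_ * _]mulr1.
have d1 : is_derive x 1 (fun t : R => t + c) 1.
  have -> : (fun t : R => t + c) = id + cst c by [].
  by rewrite -[X in is_derive _ _ _ X]addr0; apply: is_deriveD.
exact: (@is_derive1_comp _ ((powR (R:=R))^~ e) (fun t : R => t + c) x _ _
  (is_derive1_powR e xc) d1).
Qed.

Lemma is_derive_power_tail (c x : R) : 0 < x + c ->
  is_derive x 1 (fun t : R => (1 - s)^-1 * (t + c) `^ (1 - s)) ((x + c) `^ (- s)).
Proof.
move=> xc; have d := is_derive_shift_powR (1 - s) xc.
apply: (is_derive_eq (is_deriveZ (1 - s)^-1 d)).
rewrite /GRing.scale /= mulKf; last by rewrite subr_eq0 lt_eqF.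
by congr (_ `^ _); ring.
Qed.

Lemma powR_pinfty (e c : R) : 0 < e -> (x + c) `^ e @[x --> +oo] --> +oo.
Proof.
move=> e0; apply/cvgryPge => A; near=> x.
have h : `|A| `^ e^-1 <= x + c.
  by rewrite -lerBlDr; near: x; apply: nbhs_pinfty_ge; exact: num_real.
apply: (le_trans (ler_norm A)).
rewrite -[leLHS]powRr1// -(mulVf (lt0r_neq0 e0)) powRrM.
apply: ge0_ler_powR => //; rewrite ?nnegrE ?powR_ge0//; first exact: ltW.
by apply: le_trans h; exact: powR_ge0.
Unshelve. all: end_near. Qed.

Lemma power_tail_cvg0 (c : R) :
  ((1 - s)^-1 * (x + c) `^ (1 - s)) @[x --> +oo] --> 0.
Proof.
rewrite -[X in _ --> X](mulr0 (1 - s)^-1); apply: cvgMr.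
have e0 : 0 < s - 1 by rewrite subr_gt0.
have -> : (fun x : R => (x + c) `^ (1 - s)) = (fun x => ((x + c) `^ (s - 1))^-1).
  by apply/funext => x; rewrite -powRN opprB.
apply/gtr0_cvgV0; last exact: powR_pinfty.
near=> x; apply: powR_gt0; rewrite -ltrBlDr sub0r.
by near: x; apply: nbhs_pinfty_gt; exact: num_real.
Unshelve. all: end_near. Qed.

(** Fundamental theorem of calculus on a half-line: the antiderivative vanishes at infinity because
    s > 1. *)
Lemma integral_power_tail (a : R) :
  (\int[lebesgue_measure]_(x in `[a, +oo[) ((delta + (x - a)) `^ (- s))%:E =
   (delta `^ (1 - s) / (s - 1))%:E)%E.
Proof.
pose F (t : R) := (1 - s)^-1 * (t + (delta - a)) `^ (1 - s).
pose f (t : R) := (t + (delta - a)) `^ (- s).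
have pos x : a <= x -> 0 < x + (delta - a).
  by move=> ax; rewrite addrCA ltr_pwDl// subr_ge0.
have dF x : a <= x -> is_derive x 1 F (f x).
  by move=> ax; apply: is_derive_power_tail; exact: pos.
have cF x : a <= x -> {for x, continuous F}.
  move=> ax; have [dx _] := dF x ax.
  by apply: differentiable_continuous; exact/derivable1_diffP.
have cf x : a <= x -> {for x, continuous f}.
  move=> ax; have [dx _] := is_derive_shift_powR (- s) (pos _ ax).
  by apply: differentiable_continuous; exact/derivable1_diffP.
transitivity (\int[lebesgue_measure]_(x in `[a, +oo[) (f x)%:E)%E.
  by apply: eq_integral => x _; rewrite /f; congr (_ `^ _)%:E; ring.
rewrite (@ge0_continuous_FTC2y _ f F a 0).
- rewrite sub0e -EFinN; congr EFin; rewrite /F.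
  have -> : a + (delta - a) = delta by ring.
  by rewrite -mulNr -invrN opprB mulrC.
- by move=> x _; exact: powR_ge0.
- apply: continuous_in_subspaceT => x.
  by rewrite inE /= in_itv /= andbT => ax; exact: cf.
- exact: power_tail_cvg0.
- by move=> x ax; have [] := dF x (ltW ax).
- apply: cvg_at_right_filter; exact: cF.
- move=> x; rewrite in_itv /= andbT => ax.
  by have h := dF x (ltW ax); rewrite derive1E; exact: derive_val.
Qed.

(** With [delta] = 1 - r |z_n|, [s] = 2q and [a] an argument of z_n within pi of [t], a constant
    multiple of this dominates |1 - conj(z_n) r e^(it)|^(-2q). *)
Definition power_kernel (a t : R) : R := (delta + `|t - a|) `^ (- s).

Lemma power_kernel_continuous (a : R) : continuous (power_kernel a).
Proof.
move=> x.
have p0 : 0 < delta + `|x - a| by rewrite ltr_wpDr.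
have [dx _] := is_derive1_powR (- s) p0.
have c1 : {for delta + `|x - a|, continuous ((powR (R:=R))^~ (- s))}.
  by apply: differentiable_continuous; exact/derivable1_diffP.
apply: (@continuous_comp _ _ _ (fun t : R => delta + `|t - a|)
  ((powR (R:=R))^~ (- s))) => //.
apply: cvgD; first exact: cvg_cst.
apply: cvg_norm; apply: cvgB; [exact: cvg_id|exact: cvg_cst].
Qed.

Lemma measurable_power_kernel (a : R) (D : set R) :
  measurable D -> measurable_fun D (EFin \o power_kernel a).
Proof.
move=> mD; apply/measurable_EFinP; apply: (@measurable_funS _ _ _ _ setT) => //.
by apply: continuous_measurable_fun; exact: power_kernel_continuous.
Qed.

(** The interval is enlarged to the whole line and split at [a]; each half-line contributes one
    [integral_power_tail], the left one after reflection. *)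
Lemma integral_power_kernel_le (a b c : R) :
  (\int[lebesgue_measure]_(t in `[b, c]) (power_kernel a t)%:E <=
   (2 * (delta `^ (1 - s) / (s - 1)))%:E)%E.
Proof.
have k0 t : (0 <= (power_kernel a t)%:E)%E by rewrite lee_fin powR_ge0.
have mL : measurable (`]-oo, a[%classic : set R) by exact: measurable_itv.
have mR : measurable (`[a, +oo[%classic : set R) by exact: measurable_itv.
apply: (@le_trans _ _
  (\int[lebesgue_measure]_(t in `]-oo, a[ `|` `[a, +oo[) (power_kernel a t)%:E)%E).
  apply: ge0_subset_integral => //=.
  - exact: measurableU.
  - by apply: measurable_power_kernel; exact: measurableU.
  - by move=> x _ /=; rewrite !in_itv /= andbT; case: (ltP x a) => _; [left|right].
rewrite ge0_integral_setU//; last 2 first.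
- by apply: measurable_power_kernel; exact: measurableU.
- apply/disj_setPS => x /= []; rewrite !in_itv /= andbT => xa ax.
  by have := lt_le_trans xa ax; rewrite ltxx.
rewrite mulr_natl mulr2n EFinD; apply: leeD.
  apply: (@le_trans _ _
    (* The endpoint is written as a negative, as the substitution t = -x requires. *)
    (\int[lebesgue_measure]_(t in `]-oo, (- (- a))%R]) (power_kernel a t)%:E)%E).
    apply: ge0_subset_integral => //=.
    - exact: measurable_power_kernel.
    - by move=> x /=; rewrite !in_itv /= opprK => /ltW.
  rewrite ge0_integration_by_substitutionNy; last 2 first.
  - by apply: continuous_subspaceT; exact: power_kernel_continuous.
  - by move=> x _; exact: powR_ge0.
  rewrite -(integral_power_tail (- a)) le_eqVlt; apply/orP; left; apply/eqP.
  apply: eq_integral => x; rewrite inE /= in_itv /= andbT => ax.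
  rewrite /power_kernel; congr (_ `^ _)%:E; congr (_ + _).
  rewrite ler0_norm; last lra.
  by ring.
rewrite -(integral_power_tail a) le_eqVlt; apply/orP; left; apply/eqP.
apply: eq_integral => x; rewrite inE /= in_itv /= andbT => ax.
by rewrite /power_kernel ger0_norm// subr_ge0.
Qed.

End PowerKernel.

(** * Subadditivity of powers and lower bounds for sine and cosine *)

Section Trig.
Context {R : realType}.

(** The fractions x / (x + y) and y / (x + y) add up to 1, and a fraction in [0, 1] is at most its
    q-th power. *)
Lemma powR_subadditive (q x y : R) : 0 < q <= 1 -> 0 <= x -> 0 <= y ->
  (x + y) `^ q <= x `^ q + y `^ q.
Proof.
move=> /andP[q0 q1] x0 y0.
have [S0|S0] := eqVneq (x + y) 0.
  by rewrite S0 powR0 ?gt_eqF// addr_ge0 ?powR_ge0.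
have Sp : 0 < x + y by rewrite lt0r S0 addr_ge0.
have key t : 0 <= t <= x + y -> (x + y) `^ q * (t / (x + y)) <= t `^ q.
  move=> /andP[t0 ts].
  have [->|tn] := eqVneq t 0; first by rewrite mul0r mulr0 powR_ge0.
  have tp : 0 < t by rewrite lt0r tn.
  rewrite -[in leRHS](mulfVK S0 t) [in leRHS]mulrC powRM ?divr_ge0 ?(ltW Sp)//.
  rewrite ler_wpM2l ?powR_ge0// -[leLHS]powRr1 ?divr_ge0 ?(ltW Sp)//.
  by apply: ger_powR; rewrite ?divr_gt0 //= ler_pdivrMr// mul1r.
have hx := key x; have hy := key y.
have : (x + y) `^ q * (x / (x + y)) + (x + y) `^ q * (y / (x + y)) <= x `^ q + y `^ q.
  by apply: lerD; [apply: hx|apply: hy]; rewrite ?x0 ?y0 ?lerDl ?lerDr.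
by rewrite -mulrDr -mulrDl divff// mulr1.
Qed.

Lemma powR_sum_le (q : R) (f : nat -> R) (N : nat) : 0 < q <= 1 ->
  (forall n, 0 <= f n) ->
  (\sum_(0 <= n < N) f n) `^ q <= \sum_(0 <= n < N) f n `^ q.
Proof.
move=> q01 f0; elim: N => [|N IH].
  by rewrite !big_geq// powR0// gt_eqF//; case/andP: q01.
rewrite !big_nat_recr//=; apply: le_trans (powR_subadditive q01 _ _) _ => //.
  by rewrite sumr_ge0.
by rewrite lerD2r.
Qed.

(** With u = y / 2, the mean value theorem gives sin u >= u cos u, so sin y = 2 sin u cos u >= y
    cos^2 u, and cos^2 u >= 1/2 because u <= pi / 4. *)
Lemma sin_ge_half (y : R) : 0 <= y <= pi / 2 -> y / 2 <= sin y.
Proof.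
move=> /andP[y0 y1].
have [->|yn] := eqVneq y 0; first by rewrite sin0 mul0r.
have yp : 0 < y by rewrite lt0r yn.
pose u := y / 2; have u0 : 0 < u by rewrite divr_gt0.
have pi0 := pi_gt0 R.
have u4 : u <= pi / 4 by rewrite /u; lra.
have yE : y = u *+ 2 by rewrite mulr2n /u; lra.
have cosu0 : 0 <= cos u by apply: cos_ge0_pihalf; lra.
have cosu : 1 / 2 <= cos u ^+ 2.
  have : 0 <= cos (u *+ 2) by apply: cos_ge0_pihalf; rewrite -yE; lra.
  rewrite cos_mulr2n; lra.
have [c] : exists2 c, c \in `]0, u[ & sin u - sin 0 = cos c * (u - 0).
  apply: (@MVT R sin cos) => //.
  by apply: continuous_subspaceT; exact: continuous_sin.
rewrite in_itv /= sin0 !subr0 => /andP[c0 cu] sinu.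
have cc : cos u <= cos c by rewrite ltW// ltr_cos ?in_itv//=; lra.
rewrite yE sin_mulr2n sinu -yE -/u mulr2n.
have : cos u * cos u <= cos u * cos c by rewrite ler_wpM2l.
nra.
Qed.

(** Half-angle formula: 1 - cos x = 2 sin^2(x / 2), with sin(|x| / 2) >= |x| / 4. *)
Lemma one_sub_cos_ge (x : R) : `|x| <= pi -> x ^+ 2 / 8 <= 1 - cos x.
Proof.
move=> xpi.
have -> : cos x = cos `|x|.
  by case: (ger0P x) => // _; rewrite cosN.
rewrite -(real_normK (num_real x)); set y := `|x| in xpi *.
have y0 : 0 <= y by exact: normr_ge0.
have pi0 := pi_gt0 R.
have h : y / 2 / 2 <= sin (y / 2) by apply: sin_ge_half; lra.
have -> : cos y = cos ((y / 2) *+ 2) by congr cos; rewrite mulr2n; lra.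
rewrite cos_mulr2n cos2sin2 mulr2n.
nra.
Qed.

(** The arguments of the zeros are arbitrary reals; once they lie in [0, 2 pi], three kernel centers
    suffice. *)
Lemma angle_reduction (theta : R) : exists2 theta' : R,
  0 <= theta' <= 2 * pi & cos theta' = cos theta /\ sin theta' = sin theta.
Proof.
have pi0 := pi_gt0 R.
have P2 : 0 < 2 * pi :> R by lra.
have periodz (f : R -> R) : periodic f (pi *+ 2) ->
    forall (k : int) x, f (x + (2 * pi) * k%:~R) = f x.
  move=> pf [n|n] x.
    rewrite -[RHS](periodicn pf n); congr f.
    by rewrite -pmulrn -[pi *+ 2]mulr_natl mulr_natr.
  rewrite NegzE mulrNz mulrN -[LHS](periodicn pf n.+1); congr f.
  by rewrite -pmulrn -[pi *+ 2]mulr_natl mulr_natr subrK.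
have := floor_itv (theta / (2 * pi)); set k := Num.floor _ => /andP[k1 k2].
exists (theta + (2 * pi) * (- k)%:~R); last first.
  by rewrite !periodz//; [exact: sinD2pi|exact: cosD2pi].
move: k1 k2; rewrite ler_pdivlMr// ltr_pdivrMr// intrD mulr1z mulrNz => k1 k2.
by apply/andP; split; lra.
Qed.

End Trig.

(** * Integrals over circles *)

Section Polar.
Context {R : realType}.
Implicit Types r t rho theta : R.

Lemma cmod_polar r t : 0 <= r -> cmod (polar r t) = r.
Proof.
move=> r0; apply/eqP; rewrite -(eqrXn2 (n := 2)) ?cmod_ge0//.
rewrite sqr_cmod /= !exprMn -mulrDr cos2Dsin2 mulr1; exact: eqxx.
Qed.

Lemma sqr_cmod_pick_polar rho theta r t :
  cmod (1 - conjc (polar rho theta) * polar r t) ^+ 2 =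
  (1 - r * rho) ^+ 2 + 2 * (r * rho) * (1 - cos (t - theta)).
Proof.
rewrite sqr_cmod /= cosB.
have := cos2Dsin2 theta; have := cos2Dsin2 t.
set c := cos t; set s := sin t; set c' := cos theta; set s' := sin theta => h1 h2.
transitivity (1 - 2 * (r * rho) * (c * c' + s * s') +
  (r * rho) ^+ 2 * ((c ^+ 2 + s ^+ 2) * (c' ^+ 2 + s' ^+ 2))); first by ring.
by rewrite h1 h2; ring.
Qed.

Lemma sqr_cmod_pick_polar_ge rho theta r t (x : R) : 0 < rho < 1 -> 0 < r < 1 ->
  `|x| <= pi -> cos x = cos (t - theta) ->
  (1 - r * rho + `|x|) ^+ 2 / 144 <=
  cmod (1 - conjc (polar rho theta) * polar r t) ^+ 2.
Proof.
move=> /andP[rho0 rho1] /andP[r0 r1] xpi xt; rewrite sqr_cmod_pick_polar -xt.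
have := one_sub_cos_ge xpi; have := cos_geN1 x.
rewrite -(real_normK (num_real x)); move: `|x| => y; move: (cos x) => c c1 yc.
have P0 : 0 < r * rho by rewrite mulr_gt0.
have P1 : r * rho < 1 by rewrite mulr_ilt1// ltW.
move: (r * rho) P0 P1 => P P0 P1.
(* If P >= 1/16, the terms compare one by one; if P < 1/16, then (1 - P)^2 alone is large enough, as
   1 - c <= 2. The constant 144 then follows from (1 - P + y)^2 <= 2 ((1 - P)^2 + y^2) and 1 - c >=
   y^2 / 8. *)
have h : ((1 - P) ^+ 2 + (1 - c)) / 8 <= (1 - P) ^+ 2 + 2 * P * (1 - c).
  by case: (lerP (1 / 16) P) => hP; nra.
apply: le_trans h; have := sqr_ge0 (1 - P - y).
have := sqr_ge0 (1 - P); have := sqr_ge0 y; lra.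
Qed.

(** The difference t - theta lies in [-2 pi, 2 pi], so at most one period moves it into [-pi, pi],
    where [one_sub_cos_ge] applies. *)
Lemma near_center (theta t : R) : 0 <= theta <= 2 * pi -> 0 <= t <= 2 * pi ->
  exists2 c : R, c \in [:: theta - 2 * pi; theta; theta + 2 * pi] &
    `|t - c| <= pi /\ cos (t - c) = cos (t - theta).
Proof.
move=> /andP[th0 th1] /andP[t0 t1]; have pi0 := pi_gt0 R.
have c2 (x : R) : cos (x + 2 * pi) = cos x by rewrite mulr_natl cosD2pi.
have [h1|h1] := lerP (t - theta) (- pi).
  exists (theta - 2 * pi); rewrite ?inE ?eqxx// ler_norml; split; last first.
    by rewrite -(c2 (t - theta)); congr cos; ring.
  by apply/andP; split; lra.
have [h2|h2] := lerP (t - theta) pi.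
  by exists theta; rewrite ?inE ?eqxx ?orbT// ler_norml (ltW h1) h2.
exists (theta + 2 * pi); rewrite ?inE ?eqxx ?orbT// ler_norml; split; last first.
  by rewrite -c2; congr cos; ring.
by apply/andP; split; lra.
Qed.

(** Summing over all three centers avoids a choice of center depending on [t], and the integral
    splits. *)
Definition periodized_kernel (delta s theta t : R) : R :=
  \sum_(c <- [:: theta - 2 * pi; theta; theta + 2 * pi]) power_kernel delta s c t.

Lemma power_kernel_ge0 (delta s c t : R) : 0 <= power_kernel delta s c t.
Proof. exact: powR_ge0. Qed.

Lemma periodized_kernel_ge0 (delta s theta t : R) : 0 <= periodized_kernel delta s theta t.
Proof. by apply: sumr_ge0 => c _; exact: power_kernel_ge0. Qed.

Lemma pick_term_le (q rho theta theta' r t : R) : 0 < q ->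
  0 < rho < 1 -> 0 < r < 1 -> 0 <= theta' <= 2 * pi ->
  cos theta' = cos theta -> sin theta' = sin theta -> 0 <= t <= 2 * pi ->
  ((1 - cmod (polar rho theta) ^+ 2) /
     cmod (1 - conjc (polar rho theta) * polar r t) ^+ 2) `^ q <=
  288 `^ q * ((1 - rho) `^ q * periodized_kernel (1 - r * rho) (2 * q) theta' t).
Proof.
move=> q0 rho01 r01 th01 hc hs t01.
(* The factor 2 comes from 1 - rho^2 <= 2 (1 - rho), and 144 from [sqr_cmod_pick_polar_ge]. *)
have [C0 HC] : 0 <= (288 : R) /\ 2 * 144 <= (288 : R).
  by split; [exact: ler0n|lra].
move: (288 : R) C0 HC => C C0 HC.
have -> : polar rho theta = polar rho theta' by rewrite /polar hc hs.
have [c cin [ct cc]] := near_center th01 t01.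
have rho01' := rho01; move: rho01' => /andP[rho0 rho1].
have r01' := r01; move: r01' => /andP[r0 r1].
rewrite cmod_polar ?(ltW rho0)//.
have h := sqr_cmod_pick_polar_ge rho01 r01 ct cc.
set X := cmod _ in h *; set y := 1 - r * rho + `|t - c| in h *.
have rr : r * rho < 1 by rewrite mulr_ilt1// ltW.
have y0 : 0 < y by rewrite ltr_pwDl// subr_gt0.
have X2 : 0 < X ^+ 2 by apply: lt_le_trans h; rewrite divr_gt0// exprn_gt0.
have d0 : 0 < 1 - rho by rewrite subr_gt0.
apply: (@le_trans _ _ ((C * ((1 - rho) * (y ^+ 2)^-1)) `^ q)).
  apply: ge0_ler_powR; rewrite ?nnegrE ?(ltW q0)//.
  - rewrite divr_ge0 ?(ltW X2)// subr_ge0 expr_le1 ?ltW//.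
  - by rewrite !mulr_ge0 ?invr_ge0 ?sqr_ge0 ?(ltW d0).
  have -> : 1 - rho ^+ 2 = (1 - rho) * (1 + rho) by ring.
  rewrite mulrCA -mulrA ler_wpM2l ?(ltW d0)//.
  rewrite ler_pdivrMr// mulrAC ler_pdivlMr ?exprn_gt0//.
  nra.
rewrite !powRM ?invr_ge0 ?sqr_ge0 ?mulr_ge0 ?(ltW d0)//; last first.
  by rewrite invr_ge0 sqr_ge0.
rewrite ler_wpM2l ?powR_ge0// ler_wpM2l ?powR_ge0//.
have -> : ((y ^+ 2)^-1) `^ q = power_kernel (1 - r * rho) (2 * q) c t.
  by rewrite /power_kernel -/y -powR_mulrn ?(ltW y0)// -powRN -powRrM mulNr.
rewrite /periodized_kernel (big_rem c)//= lerDl.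
by apply: sumr_ge0 => *; exact: power_kernel_ge0.
Qed.

End Polar.

(** * Integration of the bounds for the derivative *)

Section Integrals.
Context {R : realType}.

(* The integral of a nonnegative function is by construction a supremum over the
   simple functions below it; this spares proving that |B'| is measurable. *)
Lemma ge0_le_integral_dominated d (T : measurableType d) (mu : {measure set T -> \bar R})
    (D : set T) (f g : T -> \bar R) :
  (forall x, D x -> (0 <= f x)%E) -> (forall x, D x -> (f x <= g x)%E) ->
  (\int[mu]_(x in D) f x <= \int[mu]_(x in D) g x)%E.
Proof.
move=> f0 fg; rewrite !ge0_integralE//; last first.
  by move=> x Dx; exact: le_trans (f0 x Dx) (fg x Dx).
apply: le_ereal_sup => _ [k kf <-].
exists k => // x; apply: le_trans (kf x) _; rewrite /patch.
by case: ifPn => // /set_mem; exact: fg.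
Qed.

Lemma integral_periodized_kernel_le (delta s theta : R) : 0 < delta -> 1 < s ->
  (\int[lebesgue_measure]_(t in `[0%R, (2 * pi)%R])
     (periodized_kernel delta s theta t)%:E <=
   (6 / (s - 1) * delta `^ (1 - s))%:E)%E.
Proof.
move=> d0 s1; under eq_integral do rewrite /periodized_kernel -sumEFin.
rewrite ge0_integral_sum//; last 2 first.
- by move=> c; exact: measurable_power_kernel.
- by move=> c t _; rewrite lee_fin power_kernel_ge0.
(* The constant 6 counts three centers with two half-lines each. *)
apply: (@le_trans _ _
  (\sum_(c <- [:: theta - 2 * pi; theta; theta + 2 * pi]%R)
     (2 * (delta `^ (1 - s) / (s - 1)))%:E)%E).
  by apply: lee_sum => c _; exact: integral_power_kernel_le.
rewrite sumEFin lee_fin !big_cons big_nil le_eqVlt; apply/orP; left; apply/eqP.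
by ring.
Qed.

Lemma measurable_periodized_kernel (delta s theta : R) (D : set R) : 0 < delta ->
  measurable D -> measurable_fun D (EFin \o periodized_kernel delta s theta).
Proof.
move=> d0 mD; apply/measurable_EFinP; apply: measurable_sum => c.
by apply/measurable_EFinP; exact: measurable_power_kernel.
Qed.

Section Circle.
Variables (rho theta : nat -> R).
Hypothesis rho01 : forall n, 0 < rho n < 1.
Hypothesis sum_rho : blaschke_sequence (fun n => polar (rho n) (theta n)).
Variables (q p r : R).
Hypotheses (q01 : 1 / 2 < q <= 1) (qp : q <= p) (r01 : 0 < r < 1).

Let a n := polar (rho n) (theta n).
Let B := blaschke_product a.

Let r0 : 0 < r. Proof. by case/andP: r01. Qed.
Let r1 : r < 1. Proof. by case/andP: r01. Qed.
Let q0 : 0 < q. Proof. by case/andP: q01 => ? _; lra. Qed.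
Let delta0 n : 0 < 1 - r * rho n.
Proof. by have /andP[? ?] := rho01 n; rewrite subr_gt0 mulr_ilt1// ltW. Qed.

(** Write |B'|^p = |B'|^q |B'|^(p - q): the sum bound and subadditivity handle the first factor, the
    bound 2 / (1 - r) the second. Here 576 = 2 * 288, the 2 being that of
    [derive1_blaschke_sum_le]. *)
Lemma derive1_blaschke_powR_le (theta' : nat -> R) t :
  (forall n, 0 <= theta' n <= 2 * pi) ->
  (forall n, cos (theta' n) = cos (theta n) /\ sin (theta' n) = sin (theta n)) ->
  0 <= t <= 2 * pi ->
  ((cmod (derive1 B (polar r t)) `^ p)%:E <=
   (576 `^ q * (2 / (1 - r)) `^ (p - q))%:E *
   \sum_(n <oo) ((1 - rho n) `^ q *
     periodized_kernel (1 - r * rho n) (2 * q) (theta' n) t)%:E)%E.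
Proof.
move=> th01 hth t01.
pose k n := (1 - rho n) `^ q * periodized_kernel (1 - r * rho n) (2 * q) (theta' n) t.
have term n : ((1 - cmod (a n) ^+ 2) /
    cmod (1 - conjc (a n) * polar r t) ^+ 2) `^ q <= 288 `^ q * k n.
  by have [hc hs] := hth n; apply: pick_term_le.
have c0 : 0 < 288 `^ q :> R by apply: powR_gt0; rewrite ltr0n.
have cE : 576 `^ q = 2 `^ q * 288 `^ q :> R.
  by rewrite -powRM; [rewrite -natrM|exact: ler0n|exact: ler0n].
rewrite cE; move: (288 `^ q) c0 term => c c0 term {cE}.
have k0 n : (0 <= (k n)%:E)%E.
  by rewrite lee_fin mulr_ge0 ?powR_ge0 ?periodized_kernel_ge0.
have s0 : 0 < 1 - r by rewrite subr_gt0.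
rewrite -[X in (_ <= _ * X)%E]/(\sum_(n <oo) (k n)%:E)%E.
set S := (\sum_(n <oo) _)%E.
have S0 : (0 <= S)%E by apply: nneseries_ge0 => n _ _.
have C0 : 0 < 2 `^ q * c * (2 / (1 - r)) `^ (p - q).
  by rewrite !mulr_gt0// powR_gt0// divr_gt0.
(* An infinite sum makes the bound trivial, because its coefficient is positive. *)
have [Soo|Sfin] := eqVneq S +oo%E.
  by rewrite Soo gt0_muley// leey.
have Sreal : S \is a fin_num by rewrite ge0_fin_numE// lt_neqAle Sfin leey.
rewrite -(fineK Sreal) -EFinM lee_fin.
have part N : \sum_(0 <= n < N) k n <= fine S.
  by rewrite -lee_fin fineK// -sumEFin; apply: nneseries_lim_ge => n _ _; exact: k0.
have [a0 sa] := sum_rho.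
have z1 : cmod (polar r t) < 1 by rewrite cmod_polar// ltW.
have b0 n : 0 <= (1 - cmod (a n) ^+ 2) / cmod (1 - conjc (a n) * polar r t) ^+ 2.
  have [_ an1] := a0 n.
  by rewrite divr_ge0 ?sqr_ge0// subr_ge0 expr_le1 ?cmod_ge0// ltW.
(* Chosen so that M^q = c S; subadditivity shows that M bounds the partial sums. *)
pose M := (c * fine S) `^ q^-1.
have SM N : \sum_(0 <= n < N)
    ((1 - cmod (a n) ^+ 2) / cmod (1 - conjc (a n) * polar r t) ^+ 2) <= M.
  set T := (X in X <= M); have T0 : 0 <= T by rewrite sumr_ge0.
  have -> : T = (T `^ q) `^ q^-1 by rewrite -powRrM mulfV ?powRr1// gt_eqF.
  apply: ge0_ler_powR; rewrite ?nnegrE ?invr_ge0 ?powR_ge0 ?(ltW q0)//.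
    by rewrite mulr_ge0 ?(ltW c0) ?fine_ge0.
  apply: le_trans (powR_sum_le N _ b0) _.
    by rewrite q0; case/andP: q01.
  apply: le_trans (_ : c * \sum_(0 <= n < N) k n <= _); last first.
    by rewrite ler_wpM2l ?(ltW c0).
  by rewrite mulr_sumr; apply: ler_sum => n _; exact: term.
have D1 := derive1_blaschke_le (fun n => proj1 (a0 n)) (fun n => proj2 (a0 n)) sa z1.
have D2 := derive1_blaschke_sum_le (fun n => proj1 (a0 n)) (fun n => proj2 (a0 n)) sa z1 SM.
rewrite -/B in D1 D2.
have D0 := cmod_ge0 (derive1 B (polar r t)).
move: D0 D1 D2; set D := cmod _ => D0 D1 D2.
rewrite cmod_polar ?(ltW r0)// in D1.
have -> : D `^ p = D `^ q * D `^ (p - q).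
  (* For D = 0 the exponent p - q may be 0 and 0^0 = 1, but both sides vanish since p and q are
     positive. *)
  have [->|Dn0] := eqVneq D 0.
    by rewrite powR0 ?gt_eqF ?(lt_le_trans q0)// [0 `^ q]powR0 ?gt_eqF// mul0r.
  by rewrite -powRD ?Dn0 ?implybT// addrC subrK.
rewrite mulrAC ler_pM ?powR_ge0//; last first.
  apply: ge0_ler_powR; rewrite ?nnegrE ?subr_ge0// divr_ge0// ltW//.
apply: le_trans (_ : (2 * M) `^ q <= _).
  by apply: ge0_ler_powR; rewrite ?nnegrE ?(ltW q0) ?mulr_ge0 ?powR_ge0.
rewrite powRM ?powR_ge0// /M -powRrM mulVf ?gt_eqF// powRr1; last first.
  by rewrite mulr_ge0 ?(ltW c0) ?fine_ge0.
by rewrite mulrA.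
Qed.

(** Termwise integration: the n-th kernel contributes a constant times (1 - r rho_n)^(1 - 2q), so
    bounds on the weighted partial sums pass to the series. *)
Lemma circle_integral_le (A : R) :
  (forall N, \sum_(0 <= n < N) (1 - rho n) `^ q * (1 - r * rho n) `^ (1 - 2 * q) <= A) ->
  (circle_integral B p r <=
   (576 `^ q * (2 / (1 - r)) `^ (p - q) * (6 / (2 * q - 1) * A))%:E)%E.
Proof.
move=> HA.
have q2 : 1 < 2 * q by case/andP: q01 => ? _; lra.
have /choice[theta' th] n : exists x, 0 <= x <= 2 * pi /\
    (cos x = cos (theta n) /\ sin x = sin (theta n)).
  by have [x x01 hx] := angle_reduction (theta n); exists x.
have C0 : 0 <= 576 `^ q * (2 / (1 - r)) `^ (p - q).
  by rewrite mulr_ge0 ?powR_ge0.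
pose k n t := (1 - rho n) `^ q * periodized_kernel (1 - r * rho n) (2 * q) (theta' n) t.
have k0 n t : (0 <= (k n t)%:E)%E.
  by rewrite lee_fin mulr_ge0 ?powR_ge0 ?periodized_kernel_ge0.
have mk n : measurable_fun (`[0%R, (2 * pi)%R] : set R) (EFin \o k n).
  apply/measurable_EFinP; apply: measurable_funM => //.
  by apply/measurable_EFinP; exact: measurable_periodized_kernel.
rewrite /circle_integral.
apply: (@le_trans _ _ (\int[lebesgue_measure]_(t in `[0%R, (2 * pi)%R])
   ((576 `^ q * (2 / (1 - r)) `^ (p - q))%:E * \sum_(n <oo) (k n t)%:E))%E).
apply: ge0_le_integral_dominated.
- by move=> t _; rewrite lee_fin powR_ge0.
- move=> t /=; rewrite in_itv /= => t01.
  by apply: derive1_blaschke_powR_le => // n; case: (th n).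
rewrite ge0_integralZl//; last 2 first.
- by apply: ge0_emeasurable_sum => // n _; exact: mk.
- by move=> t _; apply: nneseries_ge0 => n _ _.
rewrite integral_nneseries//.
rewrite [X in (_ <= X)%E]EFinM lee_wpmul2l ?lee_fin//.
apply: lime_le.
  by apply: is_cvg_nneseries => n _ _; apply: integral_ge0 => t _.
near=> N.
apply: (@le_trans _ _ (\sum_(0 <= n < N) ((1 - rho n) `^ q *
    (6 / (2 * q - 1) * (1 - r * rho n) `^ (1 - 2 * q)))%:E)%E).
  apply: lee_sum => n _.
  under eq_integral do rewrite EFinM.
  rewrite ge0_integralZl//; last 3 first.
  - exact: measurable_periodized_kernel.
  - by move=> t _; rewrite lee_fin periodized_kernel_ge0.
  - by rewrite lee_fin powR_ge0.
  rewrite [X in (_ <= X)%E]EFinM lee_wpmul2l ?lee_fin ?powR_ge0//.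
  exact: integral_periodized_kernel_le.
rewrite sumEFin lee_fin.
under eq_bigr do rewrite mulrCA.
by rewrite -mulr_sumr ler_wpM2l// divr_ge0// subr_ge0 ltW.
Unshelve. all: end_near. Qed.

End Circle.
End Integrals.

(** * Weighted sums *)

Section WeightedSums.
Context {R : realType}.
Variables (h : R -> R) (rho : nat -> R) (q : R).
Hypotheses (h_pos : forall t, 0 < t < 1 -> 0 < h t)
  (rho01 : forall n, 0 < rho n < 1)
  (h_sum : cvgn (series (fun n => h (1 - rho n))))
  (q_itv : 1 / 2 < q <= 1)
  (h_decr : {in `]0, 1[ &, nonincreasing_fun (fun t => h t / t `^ q)})
  (h_incr : {in `]0, 1[ &, nondecreasing_fun (fun t => h t / t `^ (1 - q))}).

Lemma powR_div_le (x y e : R) : 0 < x -> x <= y -> e <= 0 -> y `^ e <= x `^ e.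
Proof.
move=> x0 xy e0; rewrite -[e]opprK !(powRN _ (- e)) lef_pV2 ?posrE ?powR_gt0//.
  by apply: ge0_ler_powR; rewrite ?oppr_ge0 ?nnegrE ?(ltW x0) ?(le_trans (ltW x0)).
exact: lt_le_trans xy.
Qed.

(** As 1 - 2q < 0, [delta] may be lowered to the larger of [s] and [d]. By x^(1 - q) = x^q x^(1 -
    2q), what remains is one of the two monotonicity hypotheses. *)
Lemma weight_le_h (s d delta : R) : 0 < s < 1 -> 0 < d < 1 ->
  s <= delta -> d <= delta ->
  d `^ q * delta `^ (1 - 2 * q) <= h d * (s `^ (1 - q) / h s).
Proof.
move=> s01 d01 sd dd; have hs := h_pos s01; have hd := h_pos d01.
move: (s01) (d01) => /andP[s0 s1] /andP[d0 d1].
have e0 : 1 - 2 * q <= 0 by case/andP: q_itv => *; lra.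
rewrite mulrA ler_pdivlMr//.
have split_e (x : R) : 0 < x -> x `^ (1 - q) = x `^ q * x `^ (1 - 2 * q).
  move=> x0; rewrite -powRD; last by rewrite (gt_eqF x0) implybT.
  by congr (_ `^ _); ring.
have [ds|sd'] := leP d s.
  have := @h_decr d s.
  rewrite !in_itv/= => /(_ d01 s01 ds); rewrite ler_pdivrMr ?powR_gt0// mulrAC.
  rewrite ler_pdivlMr ?powR_gt0// => H.
  rewrite (split_e s)// mulrA.
  apply: (@le_trans _ _ (d `^ q * s `^ (1 - 2 * q) * h s)).
    by rewrite ler_wpM2r ?(ltW hs)// ler_wpM2l ?powR_ge0// powR_div_le.
  by rewrite mulrAC ler_wpM2r ?powR_ge0// mulrC.
have := @h_incr s d.
rewrite !in_itv/= => /(_ s01 d01 (ltW sd')); rewrite ler_pdivrMr ?powR_gt0// mulrAC.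
rewrite ler_pdivlMr ?powR_gt0// => H.
apply: (@le_trans _ _ (d `^ q * d `^ (1 - 2 * q) * h s)).
  by rewrite ler_wpM2r ?(ltW hs)// ler_wpM2l ?powR_ge0// powR_div_le.
by rewrite -split_e// mulrC.
Qed.

(** Lowering [delta] to [d] leaves d^(1 - q), which is at most 1. *)
Lemma weight_le1 (d delta : R) : 0 < d < 1 -> d <= delta ->
  d `^ q * delta `^ (1 - 2 * q) <= 1.
Proof.
move=> /andP[d0 d1] dd; have /andP[q0 q1] := q_itv.
apply: (@le_trans _ _ (d `^ q * d `^ (1 - 2 * q))).
  by rewrite ler_wpM2l ?powR_ge0// powR_div_le//; lra.
rewrite -powRD; last by rewrite (gt_eqF d0) implybT.
by rewrite -[leRHS](powRr0 d); apply: ger_powR; rewrite ?d0 ?(ltW d1)//; lra.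
Qed.

Let a (r : R) n := (1 - rho n) `^ q * (1 - r * rho n) `^ (1 - 2 * q).
Let H := limn (series (fun n => h (1 - rho n))).

Let d01 n : 0 < 1 - rho n < 1.
Proof. by have /andP[? ?] := rho01 n; apply/andP; split; lra. Qed.

Let hd0 n : 0 <= h (1 - rho n). Proof. exact: ltW (h_pos (d01 n)). Qed.

Let series_mono : nondecreasing_seq (series (fun n => h (1 - rho n))).
Proof.
by apply/nondecreasing_seqP => n; rewrite /series/= big_nat_recr//= lerDl hd0.
Qed.

Lemma partial_le_lim N : \sum_(0 <= n < N) h (1 - rho n) <= H.
Proof. exact: (nondecreasing_cvgn_le series_mono h_sum N). Qed.

Lemma weight_bounds r n : 0 < r < 1 ->
  a r n <= h (1 - rho n) * ((1 - r) `^ (1 - q) / h (1 - r)) /\ a r n <= 1.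
Proof.
move=> /andP[r0 r1]; have /andP[rho0 rho1] := rho01 n.
have r' : 0 < 1 - r < 1 by apply/andP; split; lra.
split.
  apply: weight_le_h => //; first by rewrite lerD2l lerN2 ler_piMr ?ltW.
  by rewrite lerD2l lerN2 ler_piMl ?ltW.
by apply: weight_le1 => //; rewrite lerD2l lerN2 ler_piMl ?ltW.
Qed.

Lemma weighted_sum_le r N : 0 < r < 1 ->
  \sum_(0 <= n < N) a r n <= H * ((1 - r) `^ (1 - q) / h (1 - r)).
Proof.
move=> r01; have r' : 0 < 1 - r < 1 by case/andP: r01 => *; apply/andP; split; lra.
have X0 : 0 <= (1 - r) `^ (1 - q) / h (1 - r).
  by rewrite divr_ge0 ?powR_ge0// ltW// h_pos.
apply: le_trans (_ : (\sum_(0 <= n < N) h (1 - rho n)) *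
    ((1 - r) `^ (1 - q) / h (1 - r)) <= _).
  by rewrite mulr_suml; apply: ler_sum => n _; have [] := weight_bounds n r01.
by rewrite ler_wpM2r// partial_le_lim.
Qed.

(** The first [N0] weights are at most 1 each; the others are governed by a tail of the convergent
    series of h. That [N0] does not depend on [r] is what the o(1) statement needs. *)
Lemma weighted_sum_le_tail (e : R) : 0 < e -> exists N0 : nat, forall r N, 0 < r < 1 ->
  \sum_(0 <= n < N) a r n <= N0%:R + e * ((1 - r) `^ (1 - q) / h (1 - r)).
Proof.
move=> e0; have /cvgrPdist_le /(_ _ e0) [N0 _ HN] := h_sum.
exists N0 => r N r01.
have r' : 0 < 1 - r < 1 by case/andP: r01 => *; apply/andP; split; lra.
have X0 : 0 <= (1 - r) `^ (1 - q) / h (1 - r).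
  by rewrite divr_ge0 ?powR_ge0// ltW// h_pos.
have head M : \sum_(0 <= n < M) a r n <= M%:R.
  apply: (@le_trans _ _ (\sum_(0 <= n < M) 1)); last by rewrite sumr_const_nat subn0.
  by apply: ler_sum => n _; have [] := weight_bounds n r01.
have [NN0|NN0] := leqP N N0.
  apply: le_trans (head N) _; apply: (@le_trans _ _ N0%:R); first by rewrite ler_nat.
  by rewrite lerDl mulr_ge0// ltW.
rewrite (big_cat_nat (n := N0))//=; last exact: ltnW.
apply: lerD; first exact: head.
apply: (@le_trans _ _ ((\sum_(N0 <= n < N) h (1 - rho n)) *
    ((1 - r) `^ (1 - q) / h (1 - r)))).
  by rewrite mulr_suml; apply: ler_sum => n _; have [] := weight_bounds n r01.
rewrite ler_wpM2r//.
have hN := HN N0 (leqnn _); have hN' := partial_le_lim N.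
rewrite (big_cat_nat (n := N0))//= in hN'; last exact: ltnW.
move: hN; rewrite /= -/H /series/= ler_norml => /andP[_ ?]; lra.
Qed.

(** * Asymptotics of the circle integrals *)

Variable theta : nat -> R.
Hypothesis sum_rho : blaschke_sequence (fun n => polar (rho n) (theta n)).
Variable p : R.
Hypothesis qp : q <= p.

Let B := blaschke_product (fun n => polar (rho n) (theta n)).
Let w (r : R) := (1 - r) `^ (p - 1) * h (1 - r).
(** The integral times its normalization, the witness for both O(1) and o(1); [fine] is harmless
    because the integral turns out to be finite for 0 < r < 1. *)
Let g (r : R) := fine (circle_integral B p r) * w r.
Let K := 576 `^ q * 2 `^ (p - q) * (6 / (2 * q - 1)).

(** The power (1 - r)^(q - p) from the pointwise bound cancels the dependence of [w] on [p], leaving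
    h(1 - r) / (1 - r)^(1 - q). *)
Lemma circle_integral_normalized r (A : R) : 0 < r < 1 ->
  (forall N, \sum_(0 <= n < N) a r n <= A) ->
  circle_integral B p r = (g r / w r)%:E /\
  `|g r| <= K * (A * (h (1 - r) / (1 - r) `^ (1 - q))).
Proof.
move=> r01 HA; have r' : 0 < 1 - r < 1 by case/andP: r01 => *; apply/andP; split; lra.
have s0 : 0 < 1 - r by case/andP: r'.
have I0 : (0 <= circle_integral B p r)%E.
  by apply: integral_ge0 => t _; rewrite lee_fin powR_ge0.
have I1 := circle_integral_le rho01 sum_rho q_itv qp r01 HA.
have Ifin : circle_integral B p r \is a fin_num.
  by rewrite ge0_fin_numE//; apply: le_lt_trans I1 _; exact: ltry.
have w0 : 0 < w r by rewrite mulr_gt0 ?powR_gt0 ?h_pos.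
split; first by rewrite /g mulfK ?gt_eqF// fineK.
rewrite ger0_norm; last by rewrite mulr_ge0 ?fine_ge0// ltW.
have : fine (circle_integral B p r) <=
   576 `^ q * (2 / (1 - r)) `^ (p - q) * (6 / (2 * q - 1) * A).
  by rewrite -lee_fin fineK.
move=> /(ler_wpM2r (ltW w0)) /le_trans; apply.
have -> : (2 / (1 - r)) `^ (p - q) = 2 `^ (p - q) * (1 - r) `^ (q - p).
  by rewrite powRM ?invr_ge0 ?(ltW s0)// -powR_inv1 ?(ltW s0)// -powRrM mulN1r opprB.
have -> : h (1 - r) / (1 - r) `^ (1 - q) = (1 - r) `^ (q - p) * w r.
  rewrite /w mulrA -powRD; last by rewrite (gt_eqF s0) implybT.
  by rewrite mulrC -powRN; congr (_ `^ _ * _); ring.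
by rewrite /K le_eqVlt; apply/orP; left; apply/eqP; ring.
Qed.

Lemma near_left1 : \forall r \near (1 : R)^'-, 0 < r < 1.
Proof.
near=> r; apply/andP; split; near: r; first exact: nbhs_left_gt.
exact: nbhs_left_lt.
Unshelve. all: end_near. Qed.

Let K0 : 0 <= K.
Proof.
have /andP[q0 q1] := q_itv.
by rewrite !mulr_ge0 ?powR_ge0// invr_ge0; lra.
Qed.

Lemma circle_integral_bigO :
  exists2 g : R -> R, g =O_ (1^'-) (fun=> 1 : R) &
    \forall r \near 1^'-, circle_integral B p r = (g r / w r)%:E.
Proof.
exists g; last first.
  apply: filterS near_left1 => r r01.
  by have [] := circle_integral_normalized r01 (fun N => weighted_sum_le N r01).
(* The two quotients of h(1 - r) and (1 - r)^(1 - q) are reciprocal, so [K * H] remains; adding 1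
   makes the constant positive. *)
apply/eqO_exP; exists (K * `|H| + 1); first by rewrite ltr_wpDl// mulr_ge0.
apply: filterS near_left1 => r r01.
have [_] := circle_integral_normalized r01 (fun N => weighted_sum_le N r01).
have r' : 0 < 1 - r < 1 by case/andP: r01 => *; apply/andP; split; lra.
have s0 : 0 < 1 - r by case/andP: r'.
have hs := h_pos r'.
move=> /le_trans; apply; rewrite normr1 mulr1.
have -> : H * ((1 - r) `^ (1 - q) / h (1 - r)) * (h (1 - r) / (1 - r) `^ (1 - q)) = H.
  by field; rewrite !gt_eqF ?powR_gt0.
by apply: (@le_trans _ _ (K * `|H|)); rewrite ?lerDl// ler_wpM2l// ler_norm.
Qed.

Lemma circle_integral_littleo : h t / t `^ (1 - q) @[t --> 0^'+] --> 0 ->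
  exists2 g : R -> R, g =o_ (1^'-) (fun=> 1 : R) &
    \forall r \near 1^'-, circle_integral B p r = (g r / w r)%:E.
Proof.
move=> hlim; exists g; last first.
  apply: filterS near_left1 => r r01.
  by have [] := circle_integral_normalized r01 (fun N => weighted_sum_le N r01).
apply/eqoP => e e0.
(* Half of [e] goes to the tail and half to the [N0] leading terms; [K + 1] and [N0 + 1] avoid
   division by zero. *)
have e'0 : 0 < e / (2 * (K + 1)) by rewrite divr_gt0// mulr_gt0// ltr_wpDl.
have [N0 HN] := weighted_sum_le_tail e'0.
have e''0 : 0 < e / (2 * (K + 1) * (N0%:R + 1)).
  by rewrite divr_gt0// !mulr_gt0// ltr_wpDl.
(* The limit hypothesis transported by t = 1 - r, with the same radius. *)
have hl : h (1 - r) / (1 - r) `^ (1 - q) @[r --> (1 : R)^'-] --> 0.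
  move/cvgrPdist_le : hlim => hlim; apply/cvgrPdist_le => eps eps0.
  have [d /= d0 hd] := hlim _ eps0.
  exists d => //= r; rewrite /ball_ /= => rd r1; apply: hd; rewrite /ball_/=.
    by rewrite sub0r normrN.
  by rewrite subr_gt0.
move/cvgrPdist_le : hl => /(_ _ e''0) hl.
near=> r.
have r01 : 0 < r < 1 by near: r; exact: near_left1.
have [_] := circle_integral_normalized r01 (fun N => HN r N r01).
have r' : 0 < 1 - r < 1 by case/andP: r01 => *; apply/andP; split; lra.
have s0 : 0 < 1 - r by case/andP: r'.
have hs := h_pos r'.
have : `|0 - h (1 - r) / (1 - r) `^ (1 - q)| <= e / (2 * (K + 1) * (N0%:R + 1)).
  by near: r.
rewrite sub0r normrN ger0_norm ?divr_ge0 ?powR_ge0 ?(ltW hs)//.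
move=> hu /le_trans; apply; rewrite normr1 mulr1.
(* With u = h(1 - r) / (1 - r)^(1 - q), the bound becomes K (N0 u + e / (2 (K + 1))), as the tail
   carries the factor 1 / u. *)
rewrite [X in K * X]mulrDl -[e / _ * _ * _]mulrA.
have -> : (1 - r) `^ (1 - q) / h (1 - r) * (h (1 - r) / (1 - r) `^ (1 - q)) = 1.
  by field; rewrite !gt_eqF ?powR_gt0.
move: hu; set u := h (1 - r) / _ => hu; rewrite mulr1.
have hNu : N0%:R * u <= e / (2 * (K + 1)).
  apply: (@le_trans _ _ (N0%:R * (e / (2 * (K + 1) * (N0%:R + 1))))).
    by rewrite ler_wpM2l.
  have -> : e / (2 * (K + 1)) = (N0%:R + 1) * (e / (2 * (K + 1) * (N0%:R + 1))).
    by field; rewrite !gt_eqF// ltr_wpDl.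
  by rewrite ler_wpM2r ?(ltW e''0)// lerDl.
apply: (@le_trans _ _ ((K + 1) * (e / (2 * (K + 1)) + e / (2 * (K + 1))))).
  apply: ler_pM => //; rewrite ?lerDl ?lerD2r//.
  by rewrite addr_ge0 ?(ltW e'0)// mulr_ge0// divr_ge0 ?powR_ge0 ?(ltW hs).
rewrite le_eqVlt; apply/orP; left; apply/eqP.
by field; rewrite gt_eqF// ltr_wpDl.
Unshelve. all: end_near. Qed.

End WeightedSums.

Theorem theorem3p1 (R : realType) (h : R -> R) (rho theta : nat -> R)
    (h_pos : forall t, 0 < t < 1 -> 0 < h t)
    (h_cont : {within `]0, 1[, continuous h})
    (h_lim : h t @[t --> 0^'+] --> 0)
    (rho_itv : forall n, 0 < rho n < 1)
    (z_blaschke : blaschke_sequence (fun n => polar (rho n) (theta n)))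
    (h_sum : cvgn (series (fun n => h (1 - rho n))))
    (q : R) (q_itv : 1 / 2 < q <= 1)
    (h_decr : {in `]0, 1[ &, nonincreasing_fun (fun t => h t / t `^ q)})
    (h_incr : {in `]0, 1[ &, nondecreasing_fun (fun t => h t / t `^ (1 - q))}) :
  let B := blaschke_product (fun n => polar (rho n) (theta n)) in
  (forall p : R, q <= p ->
     exists2 g : R -> R, g =O_ (1^'-) (fun=> 1 : R) &
       \forall r \near 1^'-, circle_integral B p r =
         (g r / ((1 - r) `^ (p - 1) * h (1 - r)))%:E) /\
  (h t / t `^ (1 - q) @[t --> 0^'+] --> 0 ->
   forall p : R, q <= p ->
     exists2 g : R -> R, g =o_ (1^'-) (fun=> 1 : R) &
       \forall r \near 1^'-, circle_integral B p r =
         (g r / ((1 - r) `^ (p - 1) * h (1 - r)))%:E).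
Proof.
move=> B; split=> [p qp|hlim p qp].
- exact: (circle_integral_bigO h_pos rho_itv h_sum q_itv h_decr h_incr z_blaschke qp).
- exact: (circle_integral_littleo h_pos rho_itv h_sum q_itv h_decr h_incr z_blaschke qp hlim).
Qed.
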